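(* Let $G$ be an $(r,s)$-directed hypergraph with at least one arc. - For each fixed real $q\ge1$, the function $p\mapsto pq\log\lambda_{p,q}(G)$ is convex (concave upward) on the set of real $p\ge1$ with $r/p+s/q<1$. - For each fixed real $p\ge1$, the function $q\mapsto pq\log\lambda_{p,q}(G)$ is convex on the set of real $q\ge1$ with $r/p+s/q<1$.
   Context: Let $r,s$ be positive integers. An $(r,s)$-directed hypergraph $G$ consists of a finite vertex set $V(G)$ and a finite set $E(G)$ of arcs. Each arc $e$ is an ordered pair $(T(e),H(e))$ of disjoint subsets of $V(G)$ (tail and head) with $|T(e)|=r$ and $|H(e)|=s$. Write $T(G)=\bigcup_eT(e)$ and $H(G)=\bigcup_eH(e)$. For real vectors $\mathbf{x}=(x_u)_{u\in T(G)}$ and $\mathbf{y}=(y_v)_{v\in H(G)}$, indexed independently, set $P_G(\mathbf x,\mathbf y)=\sum_{e\in E(G)}\prod_{u\in T(e)}x_u\prod_{v\in H(e)}y_v$. For real $p,q\ge1$ let $\lambda_{p,q}(G)=\max\{P_G(\mathbf x,\mathbf y):\|\mathbf x\|_p=\|\mathbf y\|_q=1\}$. *)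

(* Defs.v *)
From HB Require Import structures.
From mathcomp Require Import all_boot all_order all_algebra.
From mathcomp Require Import all_classical all_reals all_analysis.

Set Implicit Arguments.
Unset Strict Implicit.
Unset Printing Implicit Defensive.

Import Order.TTheory GRing.Theory Num.Theory.
Import numFieldNormedType.Exports.

Local Open Scope ring_scope.

Record dirHypergraph (r s : nat) (V : finType) := DirHypergraph {
  arcs : {set {set V} * {set V}};
  arcsP : forall e, e \in arcs ->
    [/\ [disjoint e.1 & e.2], #|e.1| = r & #|e.2| = s] }.

Definition tails r s (V : finType) (G : dirHypergraph r s V) : {set V} :=
  (\bigcup_(e in arcs G) e.1)%SET.

Definition heads r s (V : finType) (G : dirHypergraph r s V) : {set V} :=
  (\bigcup_(e in arcs G) e.2)%SET.

(* A vector indexed by A : {set V} is represented by a function on all of V;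
   neither pnorm nor Ppoly below reads its values outside A. *)
Definition pnorm (R : realType) (V : finType) (p : R) (A : {set V})
    (x : V -> R) : R :=
  (\sum_(u in A) `|x u| `^ p) `^ p^-1.

Definition Ppoly (R : realType) r s (V : finType) (G : dirHypergraph r s V)
    (x y : V -> R) : R :=
  \sum_(e in arcs G) (\prod_(u in e.1) x u) * (\prod_(v in e.2) y v).

Definition Pvalues (R : realType) r s (V : finType) (G : dirHypergraph r s V)
    (p q : R) : set R :=
  [set z | exists x y : V -> R,
    [/\ pnorm p (tails G) x = 1, pnorm q (heads G) y = 1 & z = Ppoly G x y]]%classic.

(* This supremum is a maximum: see lambda_max below. *)
Definition lambda (R : realType) r s (V : finType) (G : dirHypergraph r s V)
    (p q : R) : R :=
  sup (Pvalues G p q).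

Lemma pnorm_eq1 (R : realType) (V : finType) (p : R) (A : {set V})
    (x : V -> R) : 1 <= p ->
  pnorm p A x = 1 <-> \sum_(u in A) `|x u| `^ p = 1.
Proof.
move=> p1; have p0 : p != 0 by rewrite gt_eqF// (lt_le_trans ltr01).
rewrite /pnorm; split => [h|h]; last by rewrite h powR1.
have S0 : 0 <= \sum_(u in A) `|x u| `^ p.
  by apply: sumr_ge0 => u _; exact: powR_ge0.
by rewrite -[LHS]powRr1// -[X in _ `^ X = _](mulVf p0) powRrM h powR1.
Qed.

Lemma continuous_norm_powR (R : realType) (p : R) : 1 <= p ->
  continuous (fun t : R => `|t| `^ p).
Proof.
move=> p1 t; have p0 : p != 0 by rewrite gt_eqF// (lt_le_trans ltr01).
have [->|t0] := eqVneq t 0.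
  rewrite /continuous_at normr0 powR0//.
  apply: (@squeeze_cvgr _ _ _ _ (fun=> 0) (fun t : R => `|t|)).
  - near=> u; rewrite powR_ge0/=.
    have u1 : `|u| <= 1.
      by near: u; exact: (@nbhs0_le R R^o 1 ltr01).
    have [->|u0] := eqVneq u 0; first by rewrite normr0 powR0.
    rewrite -[leRHS]powRr1//; apply: ger_powR => //.
    by rewrite normr_gt0 u0 u1.
  - exact: cvg_cst.
  - have := @norm_continuous R R^o 0; rewrite /continuous_at normr0; exact.
apply: (@continuous_comp _ _ _ (fun t : R => `|t|) (fun t => t `^ p)).
  exact: norm_continuous.
apply: differentiable_continuous; apply/derivable1_diffP.
by apply: derivable_powR; rewrite in_itv/= andbT normr_gt0.
Unshelve. all: by end_near. Qed.

Lemma continuous_sumr (R : realType) (T : topologicalType) (I : Type)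
    (l : seq I) (P : pred I) (F : I -> T -> R) :
  (forall i, continuous (F i)) ->
  continuous (fun t => \sum_(i <- l | P i) F i t).
Proof.
move=> cF t; elim: l => [|i l ih].
  under eq_fun do rewrite big_nil; exact: cvg_cst.
under eq_fun do rewrite big_cons; case: (P i) => //.
by apply: continuousD => //; exact: cF.
Qed.

Lemma continuous_prodr (R : realType) (T : topologicalType) (I : Type)
    (l : seq I) (P : pred I) (F : I -> T -> R) :
  (forall i, continuous (F i)) ->
  continuous (fun t => \prod_(i <- l | P i) F i t).
Proof.
move=> cF t; elim: l => [|i l ih].
  under eq_fun do rewrite big_nil; exact: cvg_cst.
under eq_fun do rewrite big_cons; case: (P i) => //.
by apply: continuousM => //; exact: cF.
Qed.

Lemma norm_le1 (R : realType) (V : finType) (p : R) (A : {set V})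
    (x : V -> R) (u : V) : 1 <= p -> u \in A ->
  \sum_(u in A) `|x u| `^ p = 1 -> `|x u| <= 1.
Proof.
move=> p1 uA h; have p0 : 0 < p by rewrite (lt_le_trans ltr01).
rewrite leNgt; apply/negP => xu.
have : `|x u| `^ p <= 1.
  by rewrite -h (bigD1 u)//= lerDl sumr_ge0// => v _; exact: powR_ge0.
rewrite leNgt => /negP; apply.
have := gt0_ltr_powR p0 _ _ xu; rewrite powR1; apply; rewrite nnegrE//.
Qed.

Lemma pnorm_delta (R : realType) (V : finType) (p : R) (A : {set V}) (u : V) :
  1 <= p -> u \in A -> pnorm p A (fun v => (v == u)%:R) = 1.
Proof.
move=> p1 uA; have p0 : p != 0 by rewrite gt_eqF// (lt_le_trans ltr01).
apply/pnorm_eq1 => //; rewrite (bigD1 u)//= eqxx normr1 powR1 big1 ?addr0//.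
by move=> v /andP[_ /negPf ->]; rewrite normr0 powR0.
Qed.

Lemma lambda_max (R : realType) (r s : nat) (V : finType)
    (G : dirHypergraph r s V) (p q : R) :
  (0 < r)%N -> (0 < s)%N -> (0 < #|arcs G|)%N -> 1 <= p -> 1 <= q ->
  Pvalues G p q (lambda G p q) /\
  (forall z, Pvalues G p q z -> z <= lambda G p q).
Proof.
move=> r0 s0 /card_gt0P[e0 e0G] p1 q1.
have p0 : p != 0 by rewrite gt_eqF// (lt_le_trans ltr01).
have q0 : q != 0 by rewrite gt_eqF// (lt_le_trans ltr01).
have [_ c1 c2] := arcsP e0G.
have /card_gt0P[u0 u0e] : (0 < #|e0.1|)%N by rewrite c1.
have /card_gt0P[v0 v0e] : (0 < #|e0.2|)%N by rewrite c2.
have u0T : u0 \in tails G by apply/bigcupP; exists e0.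
have v0H : v0 \in heads G by apply/bigcupP; exists e0.
pose T : topologicalType := prod_topology (fun _ : V + V => R : topologicalType).
pose X (f : T) (u : V) : R := f (inl u).
pose Y (f : T) (v : V) : R := f (inr v).
have cX u : continuous (X^~ u).
  exact: (@proj_continuous _ (fun _ : V + V => R : topologicalType) (inl u)).
have cY v : continuous (Y^~ v).
  exact: (@proj_continuous _ (fun _ : V + V => R : topologicalType) (inr v)).
pose nX (f : T) := \sum_(u in tails G) `|X f u| `^ p.
pose nY (f : T) := \sum_(v in heads G) `|Y f v| `^ q.
have cnX : continuous nX.
  apply: continuous_sumr => u f.
  apply: (@continuous_comp _ _ _ (X^~ u) (fun t => `|t| `^ p)); [exact: cX|].
  exact: continuous_norm_powR.
have cnY : continuous nY.
  apply: continuous_sumr => u f.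
  apply: (@continuous_comp _ _ _ (Y^~ u) (fun t => `|t| `^ q)); first exact: cY.
  exact: continuous_norm_powR.
have cP : continuous (fun f => Ppoly G (X f) (Y f)).
  apply: continuous_sumr => e f; apply: continuousM;
    by apply: continuous_prodr.
pose B := [set f : T | forall i, `[(-1) : R, 1]%classic (f i)]%classic.
pose K := (B `&` (nX @^-1` [set 1] `&` nY @^-1` [set 1]))%classic.
have KB : compact K.
  apply: compact_closedI.
    apply: (@tychonoff _ (fun _ : V + V => R : topologicalType)
      (fun=> `[(-1) : R, 1]%classic)) => i.
    exact: segment_compact.
  by apply: closedI; apply: preimage_closed => //; exact: closed_eq.
have mkK (x y : V -> R) : pnorm p (tails G) x = 1 -> pnorm q (heads G) y = 1 ->
    exists2 f, K f & Ppoly G x y = Ppoly G (X f) (Y f).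
  move=> /(pnorm_eq1 _ _ p1) hx /(pnorm_eq1 _ _ q1) hy.
  exists (fun i => match i with
    | inl u => if u \in tails G then x u else 0
    | inr v => if v \in heads G then y v else 0 end).
    split; last split.
    - case=> w; rewrite /= in_itv/= -ler_norml; case: ifPn => wA.
      + exact: (norm_le1 p1 wA hx).
      + by rewrite normr0 ler01.
      + exact: (norm_le1 q1 wA hy).
      + by rewrite normr0 ler01.
    - by rewrite /= -hx; apply: eq_bigr => u uT; rewrite /X uT.
    - by rewrite /= -hy; apply: eq_bigr => u uT; rewrite /Y uT.
  apply: eq_bigr => e eG; congr (_ * _); apply: eq_bigr => w we.
    by rewrite /X ifT//; apply/bigcupP; exists e.
  by rewrite /Y ifT//; apply/bigcupP; exists e.
have K0 : (K !=set0)%classic.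
  have [||f Kf _] := mkK (fun u => (u == u0)%:R) (fun v => (v == v0)%:R).
  - exact: pnorm_delta.
  - exact: pnorm_delta.
  - by exists f.
have [c cK cmax] := compact_EVT_max K0 KB (continuous_subspaceT cP).
have KP f : K f -> Pvalues G p q (Ppoly G (X f) (Y f)).
  move=> [_ [h1 h2]]; exists (X f), (Y f); split => //; exact/pnorm_eq1.
have PK z : Pvalues G p q z -> exists2 f, K f & z = Ppoly G (X f) (Y f).
  by move=> [x [y [hx hy ->]]]; exact: mkK.
have ub z : Pvalues G p q z -> z <= Ppoly G (X c) (Y c).
  by move=> /PK[f Kf ->]; apply: cmax; exact: mem_set.
have Pc := KP _ (set_mem cK).
suff -> : lambda G p q = Ppoly G (X c) (Y c) by [].
apply/eqP; rewrite eq_le; apply/andP; split.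
  by apply: ge_sup => //; exists (Ppoly G (X c) (Y c)).
by apply: ub_le_sup => //; exists (Ppoly G (X c) (Y c)).
Qed.

(* Main.v *)
Require Import Defs.
From HB Require Import structures.
From mathcomp Require Import all_boot all_order all_algebra.
From mathcomp Require Import all_classical all_reals all_analysis.
From mathcomp Require Import ring lra.

(** By the weighted Hölder inequality, lambda is jointly log-convex in
    (1/p, 1/q): if 1/p = a/p1 + b/p2 and 1/q = a/q1 + b/q2 with a + b = 1, a
    maximizer (x, y) for (p, q) factors as |x| = x1^a x2^b, |y| = y1^a y2^b with
    xi = |x|^(p/pi) and yi = |y|^(q/qi) of norm 1, so
    lambda(p, q) <= lambda(p1, q1)^a lambda(p2, q2)^b.
    Since phi convex makes its perspective p * phi(1/p) convex in p > 0, and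
    fixing q fixes q1 = q2 = q, this gives both claims. *)

Set Implicit Arguments.
Unset Strict Implicit.
Unset Printing Implicit Defensive.

Import Order.TTheory GRing.Theory Num.Theory.
Import numFieldNormedType.Exports.

Local Open Scope classical_set_scope.
Local Open Scope ring_scope.

Lemma prodr_powR (R : realType) (I : Type) (l : seq I) (P : pred I)
    (f : I -> R) (t : R) : (forall i, 0 <= f i) ->
  \prod_(i <- l | P i) f i `^ t = (\prod_(i <- l | P i) f i) `^ t.
Proof.
move=> f0; elim: l => [|i l ih]; first by rewrite !big_nil powR1.
by rewrite !big_cons; case: (P i); rewrite // powRM ?prodr_ge0 ?ih.
Qed.

Lemma powR_amgm (R : realType) (a b x y : R) :
  0 <= a -> 0 <= b -> a + b = 1 -> 0 <= x -> 0 <= y ->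
  x `^ a * y `^ b <= a * x + b * y.
Proof.
move=> a0 b0 ab x0 y0.
have [az|anz] := eqVneq a 0.
  have b1 : b = 1 by rewrite -ab az add0r.
  by rewrite az b1 powRr0 powRr1// mul0r add0r.
have [bz|bnz] := eqVneq b 0.
  have a1 : a = 1 by rewrite -ab bz addr0.
  by rewrite a1 bz powRr0 powRr1// mul0r addr0 mulr1 mul1r.
have agt0 : 0 < a by rewrite lt_neqAle eq_sym anz.
have bgt0 : 0 < b by rewrite lt_neqAle eq_sym bnz.
have := @conjugate_powR R (x `^ a) (y `^ b) a^-1 b^-1 (powR_ge0 _ _)
  (powR_ge0 _ _).
rewrite !invr_gt0 !invrK -!powRrM !divff// !powRr1// (mulrC a) (mulrC b).
exact.
Qed.

(** Weighted Hölder: apply [powR_amgm] to f i / A and g i / B, then sum; the right-hand sides add up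
    to at most a + b = 1. Taking upper bounds A and B instead of the sums themselves lets values of
    [lambda] be plugged in and keeps the divisors positive. *)
Lemma sum_powR_le (R : realType) (I : Type) (l : seq I) (P : pred I)
    (f g : I -> R) (a b A B : R) :
  0 <= a -> 0 <= b -> a + b = 1 -> 0 < A -> 0 < B ->
  (forall i, 0 <= f i) -> (forall i, 0 <= g i) ->
  \sum_(i <- l | P i) f i <= A -> \sum_(i <- l | P i) g i <= B ->
  \sum_(i <- l | P i) f i `^ a * g i `^ b <= A `^ a * B `^ b.
Proof.
move=> a0 b0 ab A0 B0 f0 g0 fA gB.
have AB0 : 0 < A `^ a * B `^ b by rewrite mulr_gt0// powR_gt0.
rewrite -[leRHS]mulr1.
apply: (@le_trans _ _ (\sum_(i <- l | P i)
    A `^ a * B `^ b * (a * (f i / A) + b * (g i / B)))).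
  apply: ler_sum => i _.
  have fE : f i = A * (f i / A) by rewrite mulrC divfK// gt_eqF.
  have gE : g i = B * (g i / B) by rewrite mulrC divfK// gt_eqF.
  have fA0 : 0 <= f i / A by rewrite divr_ge0// ltW.
  have gB0 : 0 <= g i / B by rewrite divr_ge0// ltW.
  rewrite {1}fE {1}gE (powRM _ (ltW A0) fA0) (powRM _ (ltW B0) gB0) mulrACA.
  by apply: ler_wpM2l; [exact: ltW|exact: powR_amgm].
rewrite -mulr_sumr; apply: ler_wpM2l; first exact: ltW.
rewrite big_split/= -!mulr_sumr -!mulr_suml -ab.
apply: lerD; apply: ler_piMr => //.
  by rewrite ler_pdivrMr// mul1r.
by rewrite ler_pdivrMr// mul1r.
Qed.

Lemma pnorm_powR (R : realType) (V : finType) (p p1 : R) (A : {set V})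
    (x : V -> R) : 1 <= p -> 1 <= p1 ->
  pnorm p A x = 1 -> pnorm p1 A (fun u => `|x u| `^ (p / p1)) = 1.
Proof.
move=> p_ge1 p1_ge1 /(pnorm_eq1 _ _ p_ge1) xE; apply/pnorm_eq1 => //.
rewrite -[RHS]xE; apply: eq_bigr => u _.
rewrite ger0_norm ?powR_ge0// -powRrM divfK// gt_eqF//.
exact: lt_le_trans p1_ge1.
Qed.

(** Supplies a strictly positive unit vector, the test vector for [lambda_gt0]. *)
Lemma pnorm_const (R : realType) (V : finType) (p : R) (A : {set V}) :
  1 <= p -> (0 < #|A|)%N -> pnorm p A (fun=> #|A|%:R `^ (- p^-1)) = 1.
Proof.
move=> p1 A0; apply/pnorm_eq1 => //.
have p0 : p != 0 by rewrite gt_eqF// (lt_le_trans ltr01).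
rewrite sumr_const ger0_norm ?powR_ge0// -powRrM mulNr mulVf//.
by rewrite powR_inv1 ?ler0n// -(mulr_natr _^-1) mulVf// pnatr_eq0 -lt0n.
Qed.

(** Lets a maximizer be replaced by its absolute value, whose real powers multiply as expected. *)
Lemma Ppoly_le_norm (R : realType) r s (V : finType)
    (G : dirHypergraph r s V) (x y : V -> R) :
  Ppoly G x y <= Ppoly G (fun u => `|x u|) (fun v => `|y v|).
Proof.
by apply: ler_sum => e _; rewrite (le_trans (ler_norm _))// normrM !normr_prod.
Qed.

(* The weights [c x / z] and [d y / z] turn [1 / z] into the mean of [1 / x] and
   [1 / y], which is what makes [z * phi (1 / z)] convex when [phi] is. *)
Lemma perspective_weights (R : realFieldType) (c d x y z : R) :
  0 <= c -> 0 <= d -> c + d = 1 -> 1 <= x -> 1 <= y -> z = c * x + d * y ->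
  [/\ 1 <= z, 0 <= c * x / z, 0 <= d * y / z, c * x / z + d * y / z = 1 &
      z^-1 = c * x / z / x + d * y / z / y].
Proof.
move=> c0 d0 cd x1 y1 zE.
have z1 : 1 <= z by rewrite zE; nra.
have x0 : 0 < x by exact: lt_le_trans x1.
have y0 : 0 < y by exact: lt_le_trans y1.
have z0 : 0 < z by exact: lt_le_trans z1.
split => //.
- by rewrite divr_ge0 ?mulr_ge0// ltW.
- by rewrite divr_ge0 ?mulr_ge0// ltW.
- by rewrite -mulrDl -zE divff// gt_eqF.
- have -> : d = 1 - c by rewrite -cd addrAC subrr add0r.
  by field; rewrite !gt_eqF.
Qed.

(** The hypothesis on [phi] is convexity in the variable 1/z. Used with the weights of
    [perspective_weights] and multiplied by z, it loses the denominators z and becomes convexity of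
    p * phi p. *)
Lemma convex_perspective (R : realType) (D : set R) (phi : R -> R) :
  (forall p, D p -> 1 <= p) ->
  (forall a b x y z, 0 <= a -> 0 <= b -> a + b = 1 ->
     1 <= x -> 1 <= y -> 1 <= z -> z^-1 = a / x + b / y ->
     phi z <= a * phi x + b * phi y) ->
  convex_function (E := R^o) D (fun p : R => p * phi p).
Proof.
move=> D1 phiP t /= x y; rewrite !inE => /D1 x1 /D1 y1.
have t1 : 0 <= 1 - t%:inum by rewrite subr_ge0; exact: le1.
have [z1 a0 b0 ab zV] :=
  perspective_weights (ge0 t) t1 (subrKC _ _) x1 y1 erefl.
have phi_le := phiP _ _ _ _ _ a0 b0 ab x1 y1 z1 zV.
(* An abstract [z] stands for the convex combination, so that [field] treats it as an atom. *)
suff key (z : R) : 1 <= z ->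
    phi z <= t%:inum * x / z * phi x + (1 - t%:inum) * y / z * phi y ->
    z * phi z <= t%:inum * (x * phi x) + (1 - t%:inum) * (y * phi y).
  exact: key z1 phi_le.
move=> {a0 b0 ab zV phi_le}z1.
have z0 : 0 < z := lt_le_trans ltr01 z1.
rewrite -(ler_pM2l z0) => /le_trans; apply.
rewrite le_eqVlt; apply/orP; left; apply/eqP.
by move: (phi x) (phi y) => u v; field; rewrite gt_eqF.
Qed.

Section lambda.
Variables (R : realType) (r s : nat) (V : finType) (G : dirHypergraph r s V).
Hypotheses (r_gt0 : (0 < r)%N) (s_gt0 : (0 < s)%N).
Hypothesis G_arc : (0 < #|arcs G|)%N.

(** At positive constant vectors the term of a single arc is already positive and no other term is
    negative. Positivity is what allows passing between [lambda] and its logarithm. *)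
Lemma lambda_gt0 (p q : R) : 1 <= p -> 1 <= q -> 0 < lambda G p q.
Proof.
move=> p1 q1.
have /card_gt0P[e eG] := G_arc; have [_ e1 e2] := arcsP eG.
have T0 : (0 < #|tails G|)%N.
  by apply: leq_trans (subset_leq_card (finset.bigcup_sup e eG)); rewrite e1.
have H0 : (0 < #|heads G|)%N.
  by apply: leq_trans (subset_leq_card (finset.bigcup_sup e eG)); rewrite e2.
have [_ lmax] := lambda_max r_gt0 s_gt0 G_arc p1 q1.
apply: lt_le_trans (lmax _ _); last first.
  by do 2 eexists; split; [exact: pnorm_const|exact: pnorm_const|reflexivity].
have c0 (A : {set V}) (t : R) : (0 < #|A|)%N -> 0 < #|A|%:R `^ t.
  by move=> A0; rewrite powR_gt0// ltr0n.
rewrite /Ppoly (bigD1 e)//= ltr_pwDl//.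
  by rewrite mulr_gt0// prodr_gt0// => ? _; exact: c0.
by apply: sumr_ge0 => f _; rewrite mulr_ge0// prodr_ge0// => ? _;
  exact: powR_ge0.
Qed.

Lemma lambda_log_convex (a b p q p1 q1 p2 q2 : R) :
  0 <= a -> 0 <= b -> a + b = 1 ->
  1 <= p -> 1 <= q -> 1 <= p1 -> 1 <= q1 -> 1 <= p2 -> 1 <= q2 ->
  p^-1 = a / p1 + b / p2 -> q^-1 = a / q1 + b / q2 ->
  ln (lambda G p q) <= a * ln (lambda G p1 q1) + b * ln (lambda G p2 q2).
Proof.
move=> a0 b0 ab p_ge1 q_ge1 p1_ge1 q1_ge1 p2_ge1 q2_ge1 pE qE.
have l1 := lambda_gt0 p1_ge1 q1_ge1; have l2 := lambda_gt0 p2_ge1 q2_ge1.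
rewrite -!ln_powR -lnM ?posrE ?powR_gt0// ler_ln ?posrE; last 2 first.
- exact: lambda_gt0.
- by rewrite mulr_gt0// powR_gt0.
have [[x [y [nx ny ->]]] _] := lambda_max r_gt0 s_gt0 G_arc p_ge1 q_ge1.
have x0 (p' : R) (z : V -> R) (A : {set V}) : 0 <= \prod_(w in A) `|z w| `^ p'.
  by apply: prodr_ge0 => *; exact: powR_ge0.
have prodE (t t1 t2 : R) (z : V -> R) (A : {set V}) :
    1 <= t -> t^-1 = a / t1 + b / t2 ->
    \prod_(w in A) `|z w| = (\prod_(w in A) `|z w| `^ (t / t1)) `^ a *
      (\prod_(w in A) `|z w| `^ (t / t2)) `^ b.
  move=> t_ge1 tE; have t0 : t != 0 by rewrite gt_eqF// (lt_le_trans ltr01).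
  (* The relation between the reciprocals, multiplied by t. *)
  have t1E : t / t1 * a + t / t2 * b = 1.
    by rewrite -(divff t0) tE mulrDr !mulrA; congr (_ + _); rewrite mulrAC.
  rewrite -!prodr_powR; do ?by move=> *; exact: powR_ge0.
  rewrite -big_split/=; apply: eq_bigr => w _.
  (* Adding exponents is legitimate even where [z w] vanishes, because their sum is 1 and not 0. *)
  by rewrite -!powRrM -powRD t1E ?oner_eq0// powRr1.
have Ple (p' q' : R) : 1 <= p' -> 1 <= q' ->
    Ppoly G (fun u => `|x u| `^ (p / p')) (fun v => `|y v| `^ (q / q'))
      <= lambda G p' q'.
  move=> p'1 q'1; apply: (lambda_max r_gt0 s_gt0 G_arc p'1 q'1).2.
  by do 2 eexists; split; [exact: pnorm_powR nx|exact: pnorm_powR ny|].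
apply: le_trans (Ppoly_le_norm _ _ _) _.
(* Hölder over the arcs: each arc's monomial splits into the a-th and b-th powers of its monomials
   at the two rescaled vectors, whose sums [Ple] bounds. *)
apply: le_trans (sum_powR_le a0 b0 ab l1 l2 _ _ (Ple _ _ p1_ge1 q1_ge1)
  (Ple _ _ p2_ge1 q2_ge1)).
- apply: ler_sum => e _.
  rewrite (prodE _ _ _ x e.1 p_ge1 pE) (prodE _ _ _ y e.2 q_ge1 qE) mulrACA.
  by rewrite (powRM a (x0 _ x _) (x0 _ y _)) (powRM b (x0 _ x _) (x0 _ y _)).
- by move=> e; apply: mulr_ge0; exact: x0.
- by move=> e; apply: mulr_ge0; exact: x0.
Qed.

End lambda.

Theorem theorem5p6 (R : realType) (r s : nat) (V : finType)
    (G : dirHypergraph r s V) (r_gt0 : (0 < r)%N) (s_gt0 : (0 < s)%N)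
    (G_arc : (0 < #|arcs G|)%N) :
  (forall q : R, 1 <= q ->
     convex_function (E := R^o)
       [set p : R | 1 <= p /\ r%:R / p + s%:R / q < 1]
       (fun p : R => p * q * ln (lambda G p q))) /\
  (forall p : R, 1 <= p ->
     convex_function (E := R^o)
       [set q : R | 1 <= q /\ r%:R / p + s%:R / q < 1]
       (fun q : R => p * q * ln (lambda G p q))).
Proof.
split=> [q q1|p p1].
(* Exhibits the function as p * phi p with phi p = q * ln (lambda G p q). *)
- rewrite [X in convex_function _ X](_ : _ =
    fun p => p * (q * ln (lambda G p q))); last first.
    by apply/funext => p; rewrite mulrA.
  apply: convex_perspective => [p []//|a b x y z a0 b0 ab x1 y1 z1 zV].
  rewrite !(mulrCA _ q) -mulrDr ler_pM2l ?(lt_le_trans ltr01)//.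
  apply: lambda_log_convex => //.
  (* The fixed exponent satisfies 1/q = a/q + b/q, since a + b = 1. *)
  by rewrite -mulrDl ab mul1r.
- rewrite [X in convex_function _ X](_ : _ =
    fun q => q * (p * ln (lambda G p q))); last first.
    by apply/funext => q; rewrite mulrCA mulrA.
  apply: convex_perspective => [q []//|a b x y z a0 b0 ab x1 y1 z1 zV].
  rewrite !(mulrCA _ p) -mulrDr ler_pM2l ?(lt_le_trans ltr01)//.
  apply: lambda_log_convex => //.
  by rewrite -mulrDl ab mul1r.
Qed.
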